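(* Let $\psi:\mathbb{R}\to\mathbb{R}$ be a piecewise smooth function and let $\theta_1\neq\theta_2\in(0,\pi)$ be such that, for $i=1,2$: $\psi(s)\sin\theta_i+s\cos\theta_i\to+\infty$ as $s\to\pm\infty$, and $s\mapsto\psi(s)\sin\theta_i+s\cos\theta_i$ has a unique local minimum. Let $\Gamma=\{(s,\psi(s)):s\in\mathbb{R}\}$ be the graph of $\psi$. Then $(\Gamma,\ell_{\theta_1}\cup\ell_{\theta_2})$ is a Heisenberg Uniqueness Pair.
   Context: For a finite complex Borel measure $\mu$ on $\mathbb{R}^2$, $\widehat{\mu}(x,y)=\int_{\mathbb{R}^2}e^{-i(xs+yt)}\,d\mu(s,t)$. For an angle $\theta$, $\ell_\theta=\{t(\cos\theta,\sin\theta):t\in\mathbb{R}\}$. $\mathcal{AC}(\Gamma)$ is the set of finite complex measures supported on $\Gamma$ and absolutely continuous with respect to arc length on $\Gamma$. For $\Lambda\subset\mathbb{R}^2$, $(\Gamma,\Lambda)$ is a Heisenberg Uniqueness Pair if every $\mu\in\mathcal{AC}(\Gamma)$ with $\widehat{\mu}=0$ on $\Lambda$ satisfies $\mu=0$. *)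

(* Defs.v *)
From mathcomp Require Import all_boot all_order all_algebra.
From mathcomp Require Import all_classical all_reals all_analysis.
Set Implicit Arguments. Unset Strict Implicit. Unset Printing Implicit Defensive.
Import Order.TTheory GRing.Theory Num.Theory.
Import numFieldNormedType.Exports.
Local Open Scope classical_set_scope.
Local Open Scope ring_scope.

Definition piecewise_smooth (R : realType) (psi : R -> R) : Prop :=
  continuous psi /\
  exists bs : seq R, sorted <%R bs /\
    (forall x, x \notin bs -> forall n, derivable (derive1n n psi) x 1) /\
    (forall b, b \in bs -> forall n,
        (exists l : R, derive1n n psi x @[x --> b^'-] --> l) /\
        (exists l : R, derive1n n psi x @[x --> b^'+] --> l)).

Definition arclen_w (R : realType) (psi : R -> R) (s : R) : R :=
  Num.sqrt (1 + (derive1 psi s) ^+ 2).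

(* A measure mu in AC(Gamma), Gamma the graph of psi, is given by a complex
   density f = u + i v with respect to arc length on Gamma, integrable:
     mu(E) = \int_{ {s | (s, psi s) \in E} } (u s + i v s) * arclen_w psi s ds. *)
Definition AC_density (R : realType) (psi : R -> R) (u v : R -> R) : Prop :=
  (@lebesgue_measure R).-integrable setT (fun s => (u s * arclen_w psi s)%:E) /\
  (@lebesgue_measure R).-integrable setT (fun s => (v s * arclen_w psi s)%:E).

Definition mu_re (R : realType) (psi u : R -> R) (E : set (R * R)) : R :=
  Rintegral (@lebesgue_measure R) [set s | E (s, psi s)]
    (fun s => u s * arclen_w psi s).
Definition mu_im (R : realType) (psi v : R -> R) (E : set (R * R)) : R :=
  Rintegral (@lebesgue_measure R) [set s | E (s, psi s)]
    (fun s => v s * arclen_w psi s).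

Definition mu_zero (R : realType) (psi u v : R -> R) : Prop :=
  forall E : set (R * R), measurable E -> mu_re psi u E = 0 /\ mu_im psi v E = 0.

(* Fourier transform  hat mu(x,y) = \int e^{-i(xs+yt)} dmu(s,t), with
   (s,t) = (s, psi s) on Gamma: real and imaginary parts. *)
Definition fourier_re (R : realType) (psi u v : R -> R) (x y : R) : R :=
  Rintegral (@lebesgue_measure R) setT
    (fun s => (u s * cos (x * s + y * psi s) + v s * sin (x * s + y * psi s))
              * arclen_w psi s).
Definition fourier_im (R : realType) (psi u v : R -> R) (x y : R) : R :=
  Rintegral (@lebesgue_measure R) setT
    (fun s => (v s * cos (x * s + y * psi s) - u s * sin (x * s + y * psi s))
              * arclen_w psi s).

Definition fourier_vanishes_on_line (R : realType) (psi u v : R -> R) (th : R) : Prop :=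
  forall t : R, fourier_re psi u v (t * cos th) (t * sin th) = 0 /\
                fourier_im psi u v (t * cos th) (t * sin th) = 0.

Definition HUP_graph_two_lines (R : realType) (psi : R -> R) (th1 th2 : R) : Prop :=
  forall u v : R -> R, AC_density psi u v ->
    fourier_vanishes_on_line psi u v th1 ->
    fourier_vanishes_on_line psi u v th2 ->
    mu_zero psi u v.

Definition is_local_min (R : realType) (g : R -> R) (x : R) : Prop :=
  \forall y \near x, g x <= g y.

Definition has_unique_local_min (R : realType) (g : R -> R) : Prop :=
  exists x0, is_local_min g x0 /\ forall x, is_local_min g x -> x = x0.

(* Main.v *)
(** Put g_i(s) = psi(s) sin th_i + s cos th_i and let W be the real or imaginary
    part of the density times the arc length weight. Vanishing of the Fourier
    transform on the line of angle th_i means that the integrals of W cos(t g_i)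
    and W sin(t g_i) vanish for all t. Hence W integrates to zero against every
    polynomial in sin(l (g_i - c)); the iterates of (3x - x^3)/2, followed by
    l -> 0, turn these into sgn(g_i - c) by dominated convergence. As g_i
    decreases and then increases, g_i(s) = g_i(t) yields that the integral of W
    over [s, t] vanishes, i.e. the primitive H(x) of W, the integral over
    (-oo, x], takes the same value at s and t.
    If H(x0) <> 0, the compact set {|H| >= |H(x0)|/2} has endpoints a < b and is
    saturated for the levels of g_1 and g_2; coercivity forces g_i(a) = g_i(b)
    for both i, so the chord from (a, psi a) to (b, psi b) is orthogonal to two
    distinct directions, which is absurd. Hence H = 0, and W = 0 almost
    everywhere by Lebesgue differentiation. *)
Require Import Defs.
From mathcomp Require Import all_boot all_order all_algebra.
From mathcomp Require Import all_classical all_reals all_analysis.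
From mathcomp Require Import measurable_realfun.
From mathcomp Require Import ring lra.
Set Implicit Arguments. Unset Strict Implicit. Unset Printing Implicit Defensive.
Import Order.TTheory GRing.Theory Num.Theory.
Import numFieldNormedType.Exports.
Local Open Scope classical_set_scope.
Local Open Scope ring_scope.

(** * Polynomial approximation of the sign function on [-1, 1] *)

Section SignApproximation.
Context (R : realType).
Implicit Types x y : R.

Lemma cos_abs_le1 y : `|cos y| <= 1.
Proof. by rewrite ler_norml cos_geN1 cos_le1. Qed.

Lemma sin_abs_le1 y : `|sin y| <= 1.
Proof. by rewrite ler_norml sin_geN1 sin_le1. Qed.

(* This odd cubic maps [-1, 1] to itself; its iterates converge there to sgn. *)
Definition sign_step (x : R) : R := (3 * x - x ^+ 3) / 2.

(** Both bounds come from the factorisations 1 + p(y) = (1 + y)^2 (2 - y) / 2 and 1 - p(y) = (1 -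
    y)^2 (2 + y) / 2, where p is [sign_step]. *)
Lemma sign_step_abs_le1 n x : `|x| <= 1 -> `|iter n sign_step x| <= 1.
Proof.
elim: n => //= n IHn /IHn; move: (iter n _ x) => y.
rewrite !ler_norml /sign_step => /andP[y0 y1].
have hl : 0 <= (1 + y) ^+ 2 * (2 - y) by rewrite mulr_ge0 ?sqr_ge0//; lra.
have hu : 0 <= (1 - y) ^+ 2 * (2 + y) by rewrite mulr_ge0 ?sqr_ge0//; lra.
by apply/andP; split; lra.
Qed.

Lemma sign_stepN x : sign_step (- x) = - sign_step x.
Proof. by rewrite /sign_step; field. Qed.

Lemma iter_sign_stepN n x : iter n sign_step (- x) = - iter n sign_step x.
Proof. by elim: n => //= n ->; rewrite sign_stepN. Qed.

(** One step multiplies the gap 1 - y by (1 - y)(2 + y) / 2, which is at most 1 - y / 2. The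
    iterates never drop below x, so this factor is at most 1 - x / 2 throughout and the gap decays
    geometrically. *)
Lemma iter_sign_step_bound n x : 0 <= x <= 1 ->
  x <= iter n sign_step x <= 1 /\ 1 - iter n sign_step x <= (1 - x / 2) ^+ n.
Proof.
move=> /andP[x0 x1]; elim: n => [|n [/andP[]]] /=.
  by rewrite lexx x1 expr0; split=> //; lra.
rewrite exprS; move: (iter n _ x) => y xy y1 IHn.
have -> : 1 - sign_step y = (1 - y) * (1 - y) * (2 + y) / 2.
  by rewrite /sign_step; field.
have q0 : 0 <= (1 - x / 2) ^+ n by rewrite exprn_ge0//; lra.
have h1 : (1 - y) * (2 + y) / 2 <= 1 - x / 2 by nra.
split.
  have hl : 0 <= y * (1 - y) * (1 + y) by rewrite !mulr_ge0//; lra.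
  have hu : 0 <= (1 - y) ^+ 2 * (2 + y) by rewrite mulr_ge0 ?sqr_ge0//; lra.
  by rewrite /sign_step; apply/andP; split; lra.
rewrite (_ : _ / 2 = ((1 - y) * (2 + y) / 2) * (1 - y)); last by field.
by apply: ler_pM => //; nra.
Qed.

Lemma cvg_iter_sign_step x : `|x| <= 1 ->
  iter n sign_step x @[n --> \oo] --> Num.sg x.
Proof.
wlog x0 : x / 0 <= x => [hw|].
  have [x0|x0] := leP 0 x; first exact: hw.
  rewrite -normrN -[x in Num.sg x]opprK sgrN => Nx1.
  rewrite (_ : (fun n => _) = (fun n => - iter n sign_step (- x))); last first.
    by apply/funext => n; rewrite iter_sign_stepN opprK.
  by apply: cvgN; apply: hw => //; rewrite oppr_ge0 ltW.
rewrite ger0_norm// => x1.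
have [->|xn0] := eqVneq x 0.
  rewrite sgr0 (_ : (fun n => _) = (fun=> 0)); first exact: cvg_cst.
  by apply/funext => n; elim: n => //= n ->; rewrite /sign_step; field.
have {}x0 : 0 < x by rewrite lt_neqAle eq_sym xn0.
rewrite gtr0_sg//.
have e0 : 1 - (1 - x / 2) ^+ n @[n --> \oo] --> (1 : R).
  rewrite -[X in _ --> X]subr0; apply: cvgB; first exact: cvg_cst.
  by apply: cvg_expr; rewrite ger0_norm; lra.
apply: (squeeze_cvgr _ e0); last exact: cvg_cst.
apply: nearW => n.
have /(iter_sign_step_bound n)[/andP[_ ->] h] : 0 <= x <= 1 by rewrite ltW.
by rewrite andbT lerBlDr -lerBlDl.
Qed.

(** For y > 0 the point y / (n + 1) eventually lies in ]0, pi[, where the sine is positive; oddness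
    gives the case y < 0. *)
Lemma cvg_sg_sin_small y :
  Num.sg (sin (n.+1%:R^-1 * y)) @[n --> \oo] --> Num.sg y.
Proof.
wlog y0 : y / 0 <= y => [hw|].
  have [y0|y0] := leP 0 y; first exact: hw.
  rewrite -[Num.sg y]opprK -sgrN.
  rewrite (_ : (fun n => _) =
      (fun n => - Num.sg (sin (n.+1%:R^-1 * (- y))))); last first.
    by apply/funext => n; rewrite mulrN sinN sgrN opprK.
  by apply: cvgN; apply: hw; rewrite oppr_ge0 ltW.
have [->|yn0] := eqVneq y 0.
  under eq_fun do rewrite mulr0 sin0.
  exact: cvg_cst.
have {}y0 : 0 < y by rewrite lt_neqAle eq_sym yn0.
rewrite gtr0_sg//.
have c0 : n.+1%:R^-1 * y @[n --> \oo] --> (0 : R).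
  rewrite -[X in _ --> X](mul0r y).
  by apply: cvgM; [exact: cvg_harmonic|exact: cvg_cst].
apply: (@cvg_near_cst _ _ (1 : R)).
near=> n; apply/gtr0_sg/sin_gt0_pi; apply/andP; split.
  by rewrite mulr_gt0.
by near: n; apply: (cvgr_lt _ c0); exact: pi_gt0.
Unshelve. all: end_near. Qed.

End SignApproximation.
Arguments sign_step {R} x.

(** * From vanishing trigonometric integrals to vanishing sign integrals *)

Section TrigonometricNullity.
Context d (T : measurableType d) (R : realType).
Variable mu : {measure set T -> \bar R}.
Implicit Types U g phi : T -> R.

Lemma integrableM_bounded U phi :
  mu.-integrable setT (EFin \o U) -> measurable_fun setT phi ->
  (forall x, `|phi x| <= 1) ->
  mu.-integrable setT (EFin \o (fun x => U x * phi x)).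
Proof.
move=> iU mphi bphi.
apply: (integrableMl measurableT iU mphi).
exists 1; split; first exact: num_real.
by move=> M M1 x _ /=; rewrite (le_trans (bphi x)) ?ltW.
Qed.

Lemma Rintegral_dominated_cvg U (phi : (T -> R)^nat) phi0 :
  mu.-integrable setT (EFin \o U) -> (forall n, measurable_fun setT (phi n)) ->
  (forall n x, `|phi n x| <= 1) ->
  (forall x, phi n x @[n --> \oo] --> phi0 x) ->
  \int[mu]_x (U x * phi n x) @[n --> \oo] --> \int[mu]_x (U x * phi0 x).
Proof.
move=> iU mphi bphi phiE.
have mphi0 : measurable_fun setT phi0.
  by apply: measurable_fun_cvg => // x _; exact: phiE.
have mU : measurable_fun setT U.
  exact/measurable_EFinP/(measurable_int mu iU).
(* Since the factors [phi n] are bounded by 1, |U| dominates the whole sequence. *)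
have [|||||iphi0 _ cphi] := @dominated_convergence _ _ _ mu setT measurableT
    (fun n x => (U x * phi n x)%:E) (fun x => (U x * phi0 x)%:E)
    (abse \o (EFin \o U)).
- by move=> n; apply/measurable_EFinP; exact: measurable_funM.
- by apply/measurable_EFinP; exact: measurable_funM.
- apply: aeW => x _; apply: cvg_EFin; first by near=> n.
  by apply: cvgM; [exact: cvg_cst|exact: phiE].
- exact: integrable_abse.
- by apply: aeW => x n _ /=; rewrite lee_fin normrM ler_piMr.
apply: fine_cvg; rewrite fineK//; exact: integrable_fin_num.
Unshelve. all: end_near. Qed.

Lemma Rintegral_dominated_eq0 U (phi : (T -> R)^nat) phi0 :
  mu.-integrable setT (EFin \o U) -> (forall n, measurable_fun setT (phi n)) ->
  (forall n x, `|phi n x| <= 1) ->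
  (forall x, phi n x @[n --> \oo] --> phi0 x) ->
  (forall n, \int[mu]_x (U x * phi n x) = 0) -> \int[mu]_x (U x * phi0 x) = 0.
Proof.
move=> iU mphi bphi phiE phi_eq0.
have := Rintegral_dominated_cvg iU mphi bphi phiE.
under eq_fun do rewrite phi_eq0.
move=> c0; apply/esym; apply: (cvg_unique _ _ c0); first exact: Rhausdorff.
exact: cvg_cst.
Qed.

(** The integral condition says that the image under [g] of the signed measure with density [U] has
    zero Fourier transform. *)
Definition trig_null g U :=
  mu.-integrable setT (EFin \o U) /\ forall t,
    \int[mu]_x (U x * cos (t * g x)) = 0 /\
    \int[mu]_x (U x * sin (t * g x)) = 0.

Variable g : T -> R.
Hypothesis mg : measurable_fun setT g.

Lemma measurable_affine_comp t c : measurable_fun setT (fun x => t * g x + c).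
Proof. by apply: measurable_funD => //; exact: measurable_funM. Qed.

Lemma measurable_cos_comp t c :
  measurable_fun setT (fun x => cos (t * g x + c)).
Proof.
apply: (measurableT_comp (f := @cos R)); last exact: measurable_affine_comp.
by apply: continuous_measurable_fun; exact: continuous_cos.
Qed.

Lemma measurable_sin_comp t c :
  measurable_fun setT (fun x => sin (t * g x + c)).
Proof.
apply: (measurableT_comp (f := @sin R)); last exact: measurable_affine_comp.
by apply: continuous_measurable_fun; exact: continuous_sin.
Qed.

Lemma integrableM_cos U t c : mu.-integrable setT (EFin \o U) ->
  mu.-integrable setT (EFin \o (fun x => U x * cos (t * g x + c))).
Proof.
move=> iU; apply: integrableM_bounded => //; first exact: measurable_cos_comp.
by move=> x; exact: cos_abs_le1.
Qed.

Lemma integrableM_sin U t c : mu.-integrable setT (EFin \o U) ->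
  mu.-integrable setT (EFin \o (fun x => U x * sin (t * g x + c))).
Proof.
move=> iU; apply: integrableM_bounded => //; first exact: measurable_sin_comp.
by move=> x; exact: sin_abs_le1.
Qed.

Lemma Rintegral_lincomb a b U V :
  mu.-integrable setT (EFin \o U) -> mu.-integrable setT (EFin \o V) ->
  \int[mu]_x (a * U x + b * V x) = a * \int[mu]_x U x + b * \int[mu]_x V x.
Proof.
move=> iU iV; rewrite RintegralD ?RintegralZl//.
- by have := integrableZl measurableT a iU.
- by have := integrableZl measurableT b iV.
Qed.

(** The addition formulas write a shifted wave as a combination of the unshifted ones. The phase
    later serves to centre the sine at a level of [g]. *)
Lemma trig_null_phase U t c : trig_null g U ->
  \int[mu]_x (U x * cos (t * g x + c)) = 0 /\
  \int[mu]_x (U x * sin (t * g x + c)) = 0.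
Proof.
move=> [iU nU]; have [cU sU] := nU t.
have iC := integrableM_cos t 0 iU.
have iS := integrableM_sin t 0 iU.
split.
- transitivity (\int[mu]_x (cos c * (U x * cos (t * g x + 0))
                          + (- sin c) * (U x * sin (t * g x + 0)))).
    by apply: eq_Rintegral => x _; rewrite addr0 cosD; ring.
  rewrite Rintegral_lincomb//.
  under eq_Rintegral do rewrite addr0; rewrite cU.
  by under eq_Rintegral do rewrite addr0; rewrite sU !mulr0 addr0.
- transitivity (\int[mu]_x (sin c * (U x * cos (t * g x + 0))
                          + cos c * (U x * sin (t * g x + 0)))).
    by apply: eq_Rintegral => x _; rewrite addr0 sinD; ring.
  rewrite Rintegral_lincomb//.
  under eq_Rintegral do rewrite addr0; rewrite cU.
  by under eq_Rintegral do rewrite addr0; rewrite sU !mulr0 addr0.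
Qed.

Lemma trig_null_lincomb a b U V : trig_null g U -> trig_null g V ->
  trig_null g (fun x => a * U x + b * V x).
Proof.
move=> nU nV; have [[iU _] [iV _]] := (nU, nV); split.
  by have := integrableD measurableT (integrableZl measurableT a iU)
    (integrableZl measurableT b iV).
move=> t.
have [cU sU] := trig_null_phase t 0 nU.
have [cV sV] := trig_null_phase t 0 nV.
split.
- transitivity (\int[mu]_x (a * (U x * cos (t * g x + 0))
                          + b * (V x * cos (t * g x + 0)))).
    by apply: eq_Rintegral => x _; rewrite addr0; ring.
  by rewrite Rintegral_lincomb ?cU ?cV ?mulr0 ?addr0//; exact: integrableM_cos.
- transitivity (\int[mu]_x (a * (U x * sin (t * g x + 0))
                          + b * (V x * sin (t * g x + 0)))).
    by apply: eq_Rintegral => x _; rewrite addr0; ring.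
  by rewrite Rintegral_lincomb ?sU ?sV ?mulr0 ?addr0//; exact: integrableM_sin.
Qed.

(** Product-to-sum formulas replace the frequencies l and t by l + t and l - t. This closure
    property, applied repeatedly, admits every polynomial in the sine without constant term. *)
Lemma trig_nullM_sin l c U : trig_null g U ->
  trig_null g (fun x => U x * sin (l * g x + c)).
Proof.
move=> nU; have [iU _] := nU; split; first exact: integrableM_sin.
move=> t.
have [cp sp] := trig_null_phase (l + t) c nU.
have [cm sm] := trig_null_phase (l - t) c nU.
split.
- transitivity (\int[mu]_x (2^-1 * (U x * sin ((l + t) * g x + c))
                          + 2^-1 * (U x * sin ((l - t) * g x + c)))).
    apply: eq_Rintegral => x _.
    have -> : (l + t) * g x + c = (l * g x + c) + t * g x by ring.
    have -> : (l - t) * g x + c = (l * g x + c) - t * g x by ring.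
    by move: (l * g x + c) => y; rewrite sinD sinB; field.
  by rewrite Rintegral_lincomb ?sp ?sm ?mulr0 ?addr0//; exact: integrableM_sin.
- transitivity (\int[mu]_x (2^-1 * (U x * cos ((l - t) * g x + c))
                          + (- 2^-1) * (U x * cos ((l + t) * g x + c)))).
    apply: eq_Rintegral => x _.
    have -> : (l + t) * g x + c = (l * g x + c) + t * g x by ring.
    have -> : (l - t) * g x + c = (l * g x + c) - t * g x by ring.
    by move: (l * g x + c) => y; rewrite cosB cosD; field.
  by rewrite Rintegral_lincomb ?cp ?cm ?mulr0 ?addr0//; exact: integrableM_cos.
Qed.

Lemma trig_nullM_iter_sign_step l c n U : trig_null g U ->
  trig_null g (fun x => U x * iter n sign_step (sin (l * g x + c))).
Proof.
(* The hypothesis is kept general in [U]: the cube in the next iterate comes from multiplying by the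
   current iterate three times. *)
elim: n U => [|n IHn] U nU /=; first exact: trig_nullM_sin.
have n1 := IHn _ nU.
have n3 := IHn _ (IHn _ n1).
rewrite [X in trig_null g X](_ : _ = fun x =>
    3 / 2 * (U x * iter n sign_step (sin (l * g x + c))) + - (1 / 2) *
    (U x * iter n sign_step (sin (l * g x + c)) *
      iter n sign_step (sin (l * g x + c)) *
      iter n sign_step (sin (l * g x + c)))).
  exact: trig_null_lincomb.
by apply/funext => x; rewrite /sign_step; field.
Qed.

Lemma Rintegral_sg_sin_eq0 l c U : trig_null g U ->
  \int[mu]_x (U x * Num.sg (sin (l * g x + c))) = 0.
Proof.
move=> nU; have [iU _] := nU.
have mi n : measurable_fun setT (fun x => iter n sign_step (sin (l * g x + c))).
  elim: n => [|n IHn] /=; first exact: measurable_sin_comp.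
  apply: measurable_funM => //; apply: measurable_funB.
    exact: measurable_funM.
  exact: measurable_funX.
apply: (Rintegral_dominated_eq0 iU mi).
- by move=> n x; exact/sign_step_abs_le1/sin_abs_le1.
- by move=> x; exact/cvg_iter_sign_step/sin_abs_le1.
(* Frequency 0 in the cosine integral gives the plain integral. *)
- move=> n; have [_ /(_ 0) [+ _]] := trig_nullM_iter_sign_step l c n nU.
  by under eq_Rintegral do rewrite mul0r cos0 mulr1.
Qed.

Lemma Rintegral_sg_eq0 U c : trig_null g U ->
  \int[mu]_x (U x * Num.sg (g x - c)) = 0.
Proof.
move=> nU; have [iU _] := nU.
(* The frequency l is 1 / (n + 1), and the phase - l c turns the argument into l (g - c). *)
pose S (n : nat) x := Num.sg (sin (n.+1%:R^-1 * g x + - (n.+1%:R^-1 * c))).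
have sE n x : S n x = Num.sg (sin (n.+1%:R^-1 * (g x - c))).
  by rewrite /S mulrBr.
have mS n : measurable_fun setT (S n).
  apply: (@measurable_fun_cvg _ _ _ _ (fun k x =>
    iter k sign_step (sin (n.+1%:R^-1 * g x + - (n.+1%:R^-1 * c))))).
    elim=> [|k IHk] /=; first exact: measurable_sin_comp.
    apply: measurable_funM => //; apply: measurable_funB.
      exact: measurable_funM.
    exact: measurable_funX.
  by move=> x _; exact/cvg_iter_sign_step/sin_abs_le1.
have S1 n x : `|S n x| <= 1 by rewrite /S normr_sg lern1; case: eqP.
apply: (Rintegral_dominated_eq0 iU mS S1).
- by move=> x; under eq_fun do rewrite sE; exact: cvg_sg_sin_small.
- by move=> n; exact: Rintegral_sg_sin_eq0.
Qed.

End TrigonometricNullity.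

(** * Coercive functions with one local minimum, and their level sets *)

Section RealFunctions.
Context (R : realType).
Implicit Types h H U : R -> R.

Lemma exists_gt_pinfty h b M : h x @[x --> +oo] --> +oo ->
  exists c, b < c /\ M < h c.
Proof.
move=> hy.
have hb : \forall c \near +oo, b < c by exact: nbhs_pinfty_gt (num_real b).
have hM : \forall c \near +oo, M < h c by exact: cvgry_gt hy M.
by have [c []] := filter_ex (filterI hb hM); exists c.
Qed.

Lemma exists_gt_ninfty h b M : h x @[x --> -oo] --> +oo ->
  exists c, c < b /\ M < h c.
Proof.
move=> hNy.
have hb : \forall c \near -oo, c < b by exact: nbhs_ninfty_lt (num_real b).
have hM : \forall c \near -oo, M < h c by exact: cvgry_gt hNy M.
by have [c []] := filter_ex (filterI hb hM); exists c.
Qed.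

(** If h b <= h a, coercivity gives c > b with h c > h a, and the minimum over [a, c] is attained in
    the open interval. That would be a local minimum to the right of m. *)
Lemma increasing_of_local_min h m : continuous h -> h x @[x --> +oo] --> +oo ->
  (forall x, is_local_min h x -> x = m) ->
  forall a b, m <= a -> a < b -> h a < h b.
Proof.
move=> ch hy um a b ma ab; rewrite ltNge; apply/negP => hba.
have [c [bc hac]] := exists_gt_pinfty b (h a) hy.
have ac := lt_trans ab bc.
have [p pac pmin] : exists2 p, p \in `[a, c]%R &
    forall t, t \in `[a, c]%R -> h p <= h t.
  by apply: EVT_min; [exact: ltW|exact: continuous_subspaceT].
have [q /andP[aq qc] qmin] : exists2 q, a < q < c &
    forall t, t \in `[a, c]%R -> h q <= h t.
  (* If the minimum sits at a, then b is a minimiser too, because h b <= h a. *)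
  have [pa|pa] := eqVneq p a.
    exists b; first by rewrite ab bc.
    by move=> t /pmin; apply: le_trans; rewrite pa.
  exists p => //; move: pac; rewrite in_itv/= => /andP[ap].
  rewrite lt_neqAle eq_sym pa ap/= le_eqVlt => /predU1P[pc|//].
  by have := pmin a; rewrite pc leNgt hac in_itv/= lexx ltW// => /(_ isT).
suff /um qm : is_local_min h q by move: aq; rewrite qm ltNge ma.
have : q \in `]a, c[ by rewrite in_itv/= aq.
move=> /near_in_itvoo; apply: filterS => t; rewrite in_itv/= => /andP[at_ tc].
by apply: qmin; rewrite in_itv/= !ltW.
Qed.

Lemma decreasing_of_local_min h m : continuous h -> h x @[x --> -oo] --> +oo ->
  (forall x, is_local_min h x -> x = m) ->
  forall a b, a < b -> b <= m -> h b < h a.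
Proof.
move=> ch hNy um a b ab bm.
have := @increasing_of_local_min (h \o -%R) (- m) _ _ _ (- b) (- a) _ _.
rewrite /= !opprK; apply.
- by move=> x; apply: continuous_comp; [exact: opp_continuous|exact: ch].
- by apply/cvgNy_compNP.
- move=> x hx; rewrite -[x]opprK; congr (- _); apply: um.
  have hx' : nbhs (- - x) (fun y => h (- x) <= h (- y)) by rewrite opprK.
  have hx'' : \forall y \near - x, h (- x) <= h (- - y).
    exact: opp_continuous hx'.
  by rewrite /is_local_min; apply: filterS hx'' => y; rewrite opprK.
- by rewrite lerN2.
- by rewrite ltrN2.
Qed.

(** Strict monotonicity on either side of the minimum m forces s < m < t whenever h s = h t. *)
Lemma unimodal_sublevel h : continuous h ->
  h x @[x --> +oo] --> +oo -> h x @[x --> -oo] --> +oo ->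
  has_unique_local_min h -> forall s t, s < t -> h s = h t -> forall x,
  (s < x < t -> h x < h s) /\ (x < s \/ t < x -> h s < h x).
Proof.
move=> ch hy hNy [m [_ um]] s t st hst x.
have inc := increasing_of_local_min ch hy um.
have dec := decreasing_of_local_min ch hNy um.
have sm : s < m.
  by rewrite ltNge; apply/negP => ms; have := inc _ _ ms st; rewrite hst ltxx.
have mt : m < t.
  by rewrite ltNge; apply/negP => tm; have := dec _ _ st tm; rewrite hst ltxx.
split=> [/andP[sx xt]|[xs|tx]].
- have [xm|mx] := leP x m; first exact: dec.
  by rewrite hst; apply: inc => //; exact: ltW.
- by apply: dec => //; exact: ltW.
- by rewrite hst; apply: inc => //; exact: ltW.
Qed.

(* If h a < h b, say, then coercivity yields a' < a at the level h b. *)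
Lemma coercive_level_endpoints h (K : set R) a b : continuous h ->
  h x @[x --> +oo] --> +oo -> h x @[x --> -oo] --> +oo ->
  K a -> K b -> a < b -> (forall x, K x -> a <= x <= b) ->
  (forall s t, s < t -> h s = h t -> K s <-> K t) -> h a = h b.
Proof.
move=> ch hy hNy Ka Kb ab Kab hK; apply/eqP; rewrite eq_le.
apply/andP; split; rewrite leNgt; apply/negP => hlt.
- have [c [bc hac]] := exists_gt_pinfty b (h a) hy.
  have [p pbc hp] : exists2 p, p \in `[b, c]%R & h p = h a.
    apply: IVT; [exact: ltW|exact: continuous_subspaceT|].
    by rewrite ge_min le_max !(ltW hlt) (ltW hac) orbT.
  move: pbc; rewrite in_itv/= => /andP[bp _].
  have ap : a < p by exact: lt_le_trans bp.
  have /Kab/andP[_ pb] : K p by apply/(hK a p ap).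
  have pb_eq : p = b by apply/eqP; rewrite eq_le pb bp.
  by move: hlt; rewrite -hp pb_eq ltxx.
- have [c [ca hbc]] := exists_gt_ninfty a (h b) hNy.
  have [p pca hp] : exists2 p, p \in `[c, a]%R & h p = h b.
    apply: IVT; [exact: ltW|exact: continuous_subspaceT|].
    by rewrite ge_min le_max !(ltW hlt) (ltW hbc) orbT.
  move: pca; rewrite in_itv/= => /andP[_ pa].
  have pb : p < b by exact: le_lt_trans ab.
  have /Kab/andP[ap _] : K p by apply/(hK p b pb).
  have pa_eq : p = a by apply/eqP; rewrite eq_le pa ap.
  by move: hlt; rewrite -hp pa_eq ltxx.
Qed.

(** The hypothesis on [h1] and [h2] makes x |-> (h1 x, h2 x) injective, whereas the two ends of a
    superlevel set of |H| would have the same image. *)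
Lemma two_coercive_levels_eq0 h1 h2 H : continuous H ->
  H x @[x --> +oo] --> 0 -> H x @[x --> -oo] --> 0 ->
  (forall h, h = h1 \/ h = h2 -> [/\ continuous h, h x @[x --> +oo] --> +oo,
     h x @[x --> -oo] --> +oo & forall s t, s < t -> h s = h t -> H s = H t]) ->
  (forall s t, s < t -> h1 s = h1 t -> h2 s <> h2 t) ->
  forall x, H x = 0.
Proof.
move=> cH Hy HNy hH h12 x0; apply/eqP/negPn/negP => Hx0.
(* Halving makes |H x0| > e strict, so that K contains points to the right of x0 and its ends are
   distinct. *)
pose e := `|H x0| / 2.
have e0 : 0 < e by rewrite divr_gt0 ?normr_gt0.
pose K := [set x | e <= `|H x|].
have cnH : continuous (fun x => `|H x|).
  by move=> x; apply: cvg_norm; exact: cH.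
have Kx0 : K x0 by rewrite /K/= /e ler_pdivrMr// ler_peMr// ler1n.
have clK : closed K.
  exact: (@preimage_closed _ _ (fun x => `|H x|) [set y | e <= y]
    (fun x _ => cnH x) (@closed_ge _ e)).
(* The limits 0 at both infinities bound K, which makes the closed set K compact. *)
have [M HM] : exists M, forall x, K x -> x <= M.
  have [M [_ HM]] : \forall x \near +oo, `|H x| < e.
    by apply: (cvgr_norm_lt _ Hy); rewrite normr0.
  by exists M => x; rewrite /K/= 2!leNgt; apply: contraNN => /HM.
have [m Hm] : exists m, forall x, K x -> m <= x.
  have [m [_ Hm]] : \forall x \near -oo, `|H x| < e.
    by apply: (cvgr_norm_lt _ HNy); rewrite normr0.
  by exists m => x; rewrite /K/= 2!leNgt; apply: contraNN => /Hm.
have cK : compact K.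
  apply: (subclosed_compact clK (@segment_compact _ m M)) => x Kx /=.
  by rewrite in_itv/= Hm// HM.
have Kn0 : K !=set0 by exists x0.
have cid : {within K, continuous (@idfun R)}.
  by apply: continuous_subspaceT => x; exact: cvg_id.
have [a /set_mem Ka amin] := compact_EVT_min Kn0 cK cid.
have [b /set_mem Kb bmax] := compact_EVT_max Kn0 cK cid.
have Kab x : K x -> a <= x <= b.
  by move=> Kx; rewrite amin ?bmax//; exact/mem_set.
have ab : a < b.
  have : e < `|H x0| by rewrite /e ltr_pdivrMr// ltr_pMr ?normr_gt0// ltr1n.
  move=> /(cvgr_norm_gt _ (cH x0))/nbhs_ex[d Hd].
  have /ltW/Kab/andP[_ yb] : e < `|H (x0 + d%:num / 2)|.
    apply: Hd; rewrite /ball/= opprD addNKr normrN gtr0_norm ?divr_gt0//.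
    by rewrite ltr_pdivrMr// ltr_pMr// ltr1n.
  have /andP[ax _] := Kab _ Kx0.
  by apply: le_lt_trans ax (lt_le_trans _ yb); rewrite ltrDl divr_gt0.
have hab h : h = h1 \/ h = h2 -> h a = h b.
  move=> /hH[ch hy hNy hst]; apply: (@coercive_level_endpoints h K) => //.
  by move=> s t st /(hst _ _ st); rewrite /K/= => ->.
by apply: (h12 a b ab); apply: hab; [left|right].
Qed.

End RealFunctions.

(** * The primitive of an integrable function *)

Section CumulativeIntegral.
Context (R : realType).
Notation mu := (@lebesgue_measure R).
Variable U : R -> R.
Hypothesis iU : mu.-integrable setT (EFin \o U).

Definition cumulative (x : R) : R := \int[mu]_(t in `]-oo, x]) U t.

Lemma integrable_itv (i : interval R) : mu.-integrable [set` i] (EFin \o U).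
Proof. by apply: integrableS iU => //; exact: measurable_itv. Qed.

Lemma cumulativeB s t : s <= t ->
  cumulative t - cumulative s = \int[mu]_(x in `]s, t]) U x.
Proof. by move=> st; apply: Rintegral_itvB => //; exact: integrable_itv. Qed.

Lemma cumulative_continuous : continuous cumulative.
Proof.
move=> x; apply/cvgrPdist_lt => e e0.
(* Absolute continuity of the integral: |U| has integral below e over any measurable set of measure
   below d. *)
have [d [d0 Hd]] := integral_normr_continuous iU e0.
have small s t : s <= t -> t - s < d -> `|cumulative t - cumulative s| < e.
  move=> st std; rewrite cumulativeB//.
  apply: (le_lt_trans (le_normr_Rintegral _ _)) => //.
    exact: integrable_itv.
  have mst : (lebesgue_measure `]s, t]%classic < d%:E)%E.
    rewrite lebesgue_measure_itv/= lte_fin.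
    by case: ifP => _; rewrite ?lte_fin// -EFinB lte_fin.
  by apply: Hd => //; exact: mst.
have : \forall y \near x, `|x - y| < d.
  by apply: (@cvgr_dist_lt _ _ _ (nbhs x) _ id) => //; exact: cvg_id.
apply: filterS => y; have [xy|/ltW yx] := leP x y.
  by rewrite distrC ger0_norm ?subr_ge0// => /(small _ _ xy); rewrite distrC.
by rewrite ger0_norm ?subr_ge0// => /(small _ _ yx).
Qed.

(** The indicator fixes the domain of integration, so dominated convergence yields the limits at
    both infinities; at each point the indicators are eventually constant. *)
Lemma cumulativeE x : cumulative x = \int[mu]_t (U t * \1_(`]-oo, x]) t).
Proof.
rewrite /cumulative Rintegral_mkcond; apply: eq_Rintegral => t _.
by rewrite patchE indicE; case: ifPn; rewrite ?mulr1 ?mulr0.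
Qed.

Lemma indic_abs_le1 (A : set R) x : `|\1_A x| <= 1 :> R.
Proof. by rewrite indicE; case: (_ \in _); rewrite ?normr1 ?normr0. Qed.

Lemma cumulative_cvg_ninfty : cumulative x @[x --> -oo] --> 0.
Proof.
apply/cvg_ninftyP => u uNy; under eq_fun do rewrite cumulativeE.
rewrite (_ : 0 = \int[mu]_x (U x * 0)); last first.
  by under eq_Rintegral do rewrite mulr0; rewrite Rintegral_cst// mul0r.
apply: Rintegral_dominated_cvg => //.
- by move=> n; exact: measurable_indic.
- by move=> n x; exact: indic_abs_le1.
- move=> x; apply: cvg_near_cst.
  have : \forall n \near \oo, u n < x by exact: cvgrNy_lt uNy x.
  by apply: filterS => n unx; rewrite indicE memNset//= in_itv/= leNgt unx.
Qed.

Lemma cumulative_cvg_pinfty : cumulative x @[x --> +oo] --> \int[mu]_x U x.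
Proof.
apply/cvg_pinftyP => u uy; under eq_fun do rewrite cumulativeE.
rewrite (_ : \int[mu]_x U x = \int[mu]_x (U x * 1)); last first.
  by apply: eq_Rintegral => x _; rewrite mulr1.
apply: Rintegral_dominated_cvg => //.
- by move=> n; exact: measurable_indic.
- by move=> n x; exact: indic_abs_le1.
- move=> x; apply: cvg_near_cst.
  have : \forall n \near \oo, x < u n by exact: cvgry_gt uy x.
  by apply: filterS => n unx; rewrite indicE mem_set//= in_itv/= ltW.
Qed.

(** By Lebesgue differentiation [U] is almost everywhere the derivative of its primitive, here the
    zero function. *)
Lemma Rintegral_eq0_of_cumulative A : (forall x, cumulative x = 0) ->
  measurable A -> \int[mu]_(x in A) U x = 0.
Proof.
move=> H0 mA.
have locU : locally_integrable setT U.
  by apply: open_integrable_locally => //; exact: openT.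
have aeU := FTC1Ny (fun y => integrable_itv _) locU.
have mU : measurable_fun A (EFin \o U).
  by apply: measurable_funTS; exact: (measurable_int mu iU).
rewrite /Rintegral (ae_eq_integral (cst 0%E))//= ?integral0//.
apply: filterS aeU; first exact: (ae_filter_ringOfSetsType mu).
move=> x [_ <-] _ /=; congr EFin.
rewrite (_ : (fun x => _) = cst 0) ?derive1_cst//.
by apply/funext => y; exact: H0.
Qed.

Lemma cumulative_eq_level h s t : trig_null mu h U -> continuous h ->
  h x @[x --> +oo] --> +oo -> h x @[x --> -oo] --> +oo ->
  has_unique_local_min h -> s < t -> h s = h t -> cumulative s = cumulative t.
Proof.
move=> nU ch hy hNy hm st hst.
have mh : measurable_fun setT h by exact: continuous_measurable_fun.
have U0 : \int[mu]_x U x = 0.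
  have [_ /(_ 0) [+ _]] := nU.
  by under eq_Rintegral do rewrite mul0r cos0 mulr1.
have sg0 := Rintegral_sg_eq0 mh (h s) nU.
have iU1 : mu.-integrable setT (EFin \o (U \_ `]s, t])).
  rewrite -restrict_EFin; apply/integrable_restrict => //.
  by rewrite setTI; exact: integrable_itv.
have iU2 : mu.-integrable setT (EFin \o (U \_ `[s, t[)).
  rewrite -restrict_EFin; apply/integrable_restrict => //.
  by rewrite setTI; exact: integrable_itv.
(* The sign of h - h s is 1 minus the indicators of ]s, t] and [s, t[: it is 1 outside [s, t], -1
   inside, and 0 at each endpoint, which lies in exactly one of the two. Endpoints being null sets,
   0 is the total integral minus twice the integral over ]s, t], and the total integral vanishes. *)
have : \int[mu]_x (U x - ((U \_ `]s, t]) x + (U \_ `[s, t[) x)) = 0.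
  rewrite -sg0; apply: eq_Rintegral => x _.
  have [hin hout] := unimodal_sublevel ch hy hNy hm st hst x.
  have patch0 (A : set R) y : (U \_ A) y = if y \in A then U y else 0.
    by rewrite patchE.
  rewrite !patch0 !mem_setE !in_itv/=.
  have [xs|sx|->] := ltgtP x s; rewrite /=.
  - by rewrite gtr0_sg ?subr_gt0 ?hout//; [ring|left].
  - have [xt|tx|->] := ltgtP x t; rewrite /=.
    + rewrite ltr0_sg ?subr_lt0 ?hin ?sx//; ring.
    + by rewrite gtr0_sg ?subr_gt0 ?hout//; [ring|right].
    + by rewrite hst subrr sgr0; ring.
  - by rewrite st subrr sgr0 ?ltW//; ring.
rewrite RintegralB//; last by have := integrableD measurableT iU1 iU2.
rewrite U0 RintegralD// -!Rintegral_mkcond.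
rewrite Rintegral_itv_bndo_bndc; last exact: integrable_itv.
rewrite -Rintegral_itv_obnd_cbnd; last exact: integrable_itv.
move=> h2; apply/esym/eqP; rewrite -subr_eq0 (cumulativeB (ltW st)).
by apply/eqP; move: h2; set I := Rintegral _ _ _; lra.
Qed.

End CumulativeIntegral.

(** * Fourier transform on the two lines and conclusion *)

(** The equation says sin(th1 - th2) = 0, and the difference lies in ]-pi, pi[. *)
Lemma sin_cos_inj (R : realType) (th1 th2 : R) : 0 < th1 < pi -> 0 < th2 < pi ->
  sin th1 * cos th2 = cos th1 * sin th2 -> th1 = th2.
Proof.
move=> h1 h2 h; apply/eqP; rewrite -subr_eq0; apply/negPn/negP => d0.
have s0 : sin (th1 - th2) = 0 by rewrite sinB h subrr.
wlog lt12 : th1 th2 h1 h2 h d0 s0 / th2 < th1 => [hw|].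
  have [lt12|lt21|e12] := ltgtP th1 th2; last by rewrite e12 subrr eqxx in d0.
  - apply: (hw th2 th1) => //.
    + by rewrite mulrC -h mulrC.
    + by rewrite -oppr_eq0 opprB.
    + by rewrite -opprB sinN s0 oppr0.
  - exact: (hw th1 th2).
have : 0 < sin (th1 - th2).
  apply: sin_gt0_pi; move: h1 h2 => /andP[? ?] /andP[? ?].
  by apply/andP; split; lra.
by rewrite s0 ltxx.
Qed.

(** The real and imaginary parts mix the two densities, as Uc + Vs and Vc - Us. Comparing t with -t
    separates them, since cosine integrals are even in t and sine integrals odd. *)
Lemma fourier_line_trig_null (R : realType) (psi u v : R -> R) th :
  AC_density psi u v -> fourier_vanishes_on_line psi u v th ->
  let g s := psi s * sin th + s * cos th in
  measurable_fun [set: measurableTypeR R] g ->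
  trig_null (@lebesgue_measure R) g (fun s => u s * arclen_w psi s) /\
  trig_null (@lebesgue_measure R) g (fun s => v s * arclen_w psi s).
Proof.
set U := fun s => u s * arclen_w psi s; set V := fun s => v s * arclen_w psi s.
move=> [iU iV] hF g mg.
have gE t s : t * cos th * s + t * sin th * psi s = t * g s by rewrite /g; ring.
have iUc t := integrableM_cos mg t 0 iU.
have iUs t := integrableM_sin mg t 0 iU.
have iVc t := integrableM_cos mg t 0 iV.
have iVs t := integrableM_sin mg t 0 iV.
pose Uc t := \int[lebesgue_measure]_s (U s * cos (t * g s + 0)).
pose Us t := \int[lebesgue_measure]_s (U s * sin (t * g s + 0)).
pose Vc t := \int[lebesgue_measure]_s (V s * cos (t * g s + 0)).
pose Vs t := \int[lebesgue_measure]_s (V s * sin (t * g s + 0)).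
have re0 t : Uc t + Vs t = 0.
  rewrite -[RHS](hF t).1 -RintegralD//; apply: eq_Rintegral => s _.
  by rewrite gE addr0 /U /V; ring.
have im0 t : Vc t - Us t = 0.
  rewrite -[RHS](hF t).2 -RintegralB//; apply: eq_Rintegral => s _.
  by rewrite gE addr0 /U /V; ring.
have UcN t : Uc (- t) = Uc t.
  by apply: eq_Rintegral => s _; rewrite !addr0 mulNr cosN.
have VcN t : Vc (- t) = Vc t.
  by apply: eq_Rintegral => s _; rewrite !addr0 mulNr cosN.
have N1 (W : R -> R) t : lebesgue_measure.-integrable setT (EFin \o W) ->
    \int[lebesgue_measure]_s (W s * sin (- t * g s + 0)) =
    - \int[lebesgue_measure]_s (W s * sin (t * g s + 0)).
  move=> iW; rewrite -[RHS]mulN1r -RintegralZl//; last exact: integrableM_sin.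
  by apply: eq_Rintegral => s _; rewrite !addr0 mulNr sinN; ring.
have UsN t : Us (- t) = - Us t by exact: N1.
have VsN t : Vs (- t) = - Vs t by exact: N1.
have z t : [/\ Uc t = 0, Us t = 0, Vc t = 0 & Vs t = 0].
  have := (re0 t, re0 (- t), im0 t, im0 (- t)).
  rewrite UcN VcN UsN VsN => -[[[e1 e2] e3] e4].
  by split; lra.
split; split=> // t; have [] := z t; rewrite /Uc /Us /Vc /Vs => z1 z2 z3 z4.
- by split; [rewrite -[RHS]z1|rewrite -[RHS]z2]; apply: eq_Rintegral => s _;
    rewrite addr0.
- by split; [rewrite -[RHS]z3|rewrite -[RHS]z4]; apply: eq_Rintegral => s _;
    rewrite addr0.
Qed.

Theorem theorem3p1 (R : realType) (psi : R -> R) (th1 th2 : R) :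
  piecewise_smooth psi ->
  th1 != th2 ->
  0 < th1 < pi -> 0 < th2 < pi ->
  (forall th, th = th1 \/ th = th2 ->
     (psi s * sin th + s * cos th @[s --> +oo] --> +oo) /\
     (psi s * sin th + s * cos th @[s --> -oo] --> +oo) /\
     has_unique_local_min (fun s => psi s * sin th + s * cos th)) ->
  HUP_graph_two_lines psi th1 th2.
Proof.
move=> [cpsi _] th12 h1 h2 hth u v iUV F1 F2 E mE.
pose g th s := psi s * sin th + s * cos th.
have cg th : continuous (g th).
  move=> s; apply: cvgD; apply: cvgM;
    [exact: cpsi|exact: cvg_cst|exact: cvg_id|exact: cvg_cst].
have mg th : measurable_fun [set: measurableTypeR R] (g th).
  exact: continuous_measurable_fun.
have mA : measurable [set s | E (s, psi s)].
  have mp : measurable_fun setT (fun s => (s, psi s)).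
    by apply: measurable_fun_pair => //; exact: continuous_measurable_fun.
  by have := mp measurableT _ mE; rewrite setTI.
have [nU1 nV1] := fourier_line_trig_null iUV F1 (mg th1).
have [nU2 nV2] := fourier_line_trig_null iUV F2 (mg th2).
(* [W] stands for either component of the density times the arc length weight. *)
suff zero W : trig_null lebesgue_measure (g th1) W ->
    trig_null lebesgue_measure (g th2) W ->
    \int[lebesgue_measure]_(s in [set s | E (s, psi s)]) W s = 0.
  by split; exact: zero.
(* Frequency 0 shows that [W] has total integral 0, so its primitive tends to 0 at +oo as well. *)
move=> nW1 nW2; have [iW /(_ 0) [+ _]] := nW1.
under eq_Rintegral do rewrite mul0r cos0 mulr1.
move=> W0; apply: (Rintegral_eq0_of_cumulative iW) => //.
apply: (@two_coercive_levels_eq0 R (g th1) (g th2)).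
- exact: cumulative_continuous.
- by rewrite -W0; exact: cumulative_cvg_pinfty.
- exact: cumulative_cvg_ninfty.
- have key th : th = th1 \/ th = th2 -> trig_null lebesgue_measure (g th) W ->
      [/\ continuous (g th), g th x @[x --> +oo] --> +oo,
        g th x @[x --> -oo] --> +oo & forall s t, s < t -> g th s = g th t ->
        cumulative W s = cumulative W t].
    move=> /hth[gy [gNy gm]] nW; split=> // s t.
    exact: (cumulative_eq_level iW nW).
  by move=> h [] ->; apply: key => //; [left|right].
- move=> s t st e1 e2.
  suff th_eq : th1 = th2 by rewrite th_eq eqxx in th12.
  apply: sin_cos_inj => //; apply/eqP; rewrite -subr_eq0.
  (* Weighting the two level equations by sin th2 and sin th1 eliminates [psi]; what remains is (t -
     s) sin(th1 - th2) = 0 with s < t. *)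
  have : (t - s) * (sin th1 * cos th2 - cos th1 * sin th2) = 0.
    transitivity
      (sin th1 * (g th2 t - g th2 s) - sin th2 * (g th1 t - g th1 s)).
      by rewrite /g; ring.
    by rewrite e1 e2 !subrr !mulr0 subrr.
  by move/eqP; rewrite mulf_eq0 [t - s == 0]subr_eq0 gt_eqF.
Qed.
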